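(* Let $M$ be an $n$-dimensional smooth manifold. Consider a system of second order ordinary differential equations (SODE) $\frac{d^2x^i}{dt^2}+2G^i(x,\dot x)=0$, $i=1,\dots,n$, and let $S\in\mathfrak{X}(TM)$ be the associated semi-spray. Suppose that the SODE can be written in an equivalent way as $\delta_SL=\sigma$, for some Lagrangian $L$ and some semi-basic $1$-form $\sigma=\sigma_i(x,\dot x)\,dx^i$, with $S(L)\neq0$ and $\mathbf{C}(L)\neq0$. Then there exists a non-constant function $\Phi:\mathbb{R}\to\mathbb{R}$, differentiable of class $C^2$, such that $S$ is a Lagrangian vector field with the corresponding Lagrangian $\Phi(L)$ if and only if the following three conditions are satisfied: (1) $\displaystyle \sigma=\frac{S(E_L)}{\mathbf{C}(L)}\,d_JL$, (2) $\displaystyle \frac{\Phi''(L)}{\Phi'(L)}=-\frac{S(E_L)}{S(L)\,\mathbf{C}(L)}$, (3) $\displaystyle \left(\Phi''\frac{\partial L}{\partial y^j}\frac{\partial L}{\partial y^i}+\Phi'\frac{\partial^2L}{\partial y^i\partial y^j}\right)_{i,j}\neq O_n$, where $O_n$ is the null $n\times n$ matrix.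
   Context: Local coordinates $(x^i)$ on $M$ induce local coordinates $(x^i,y^i)$ on the tangent bundle $TM$ (with $y^i=\dot x^i$ along lifted curves); $\mathfrak{X}(TM)$ denotes the smooth vector fields on $TM$. The Liouville vector field is $\mathbf{C}=y^i\frac{\partial}{\partial y^i}$ and the vertical endomorphism is $J=\frac{\partial}{\partial y^i}\otimes dx^i$. A semi-spray is a vector field $S$ on $TM$ with $JS=\mathbf{C}$; locally $S=y^i\frac{\partial}{\partial x^i}-2G^i(x,y)\frac{\partial}{\partial y^i}$, and it is identified with the SODE $\frac{d^2x^i}{dt^2}+2G^i(x,\dot x)=0$. A semi-basic $1$-form is a $1$-form on $TM$ that vanishes on vertical vectors, i.e. locally of the form $\sigma_i(x,y)\,dx^i$. A Lagrangian is a smooth function $L:TM\to\mathbb{R}$ whose Hessian $\left(\frac{\partial^2L}{\partial y^i\partial y^j}\right)$ with respect to the fibre coordinates is non-trivial. Its energy is $E_L=\mathbf{C}(L)-L$. The operator $d_J=i_J\circ d-d\circ i_J$ gives $d_JL=\frac{\partial L}{\partial y^i}\,dx^i$. The Lagrange differential of $L$ is the semi-basic $1$-form $\delta_SL=\mathcal{L}_Sd_JL-dL=\left\{S\left(\frac{\partial L}{\partial y^i}\right)-\frac{\partial L}{\partial x^i}\right\}dx^i$. A semi-spray $S$ is called Lagrangian, with corresponding Lagrangian $L$, if $\delta_SL=0$. Here $\Phi(L)=\Phi\circ L$ is the deformed Lagrangian, and in condition (3) $\Phi'$ and $\Phi''$ are evaluated at $L$; the matrix in (3) is the Hessian of $\Phi(L)$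 with respect to $(y^i)$. *)

(* Defs.v *)
From HB Require Import structures.
From mathcomp Require Import all_boot all_order all_algebra.
From mathcomp Require Import all_classical all_reals all_analysis.

Set Implicit Arguments.
Unset Strict Implicit.
Unset Printing Implicit Defensive.

Import Order.TTheory GRing.Theory Num.Theory.
Import numFieldNormedType.Exports.

Local Open Scope ring_scope.
Local Open Scope classical_set_scope.

(* [Ck k U f]: [f] is of class C^k on [U], which is always an open set below.
   A C^(k+1) map is a Frechet differentiable map all of whose directional
   derivatives are C^k. *)
Fixpoint Ck (R : realType) (V W : normedModType R) (k : nat) (U : set V)
    (f : V -> W) : Prop :=
  match k with
  | 0 => forall x, U x -> {for x, continuous f}
  | k'.+1 => (forall x, U x -> differentiable f x) /\
             (forall v : V, Ck k' U (fun x => 'D_v f x))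
  end.

Definition Cinfty (R : realType) (V W : normedModType R) (U : set V)
  (f : V -> W) : Prop := forall k, Ck k U f.

(* [chart_inv a] is only meaningful on [chart a @` chart_dom a]. *)
Record smooth_manifold (R : realType) (n : nat) := SmoothManifold {
  carrier :> topologicalType;
  chart_index : Type;
  chart_dom : chart_index -> set carrier;
  chart : chart_index -> carrier -> 'rV[R]_n;
  chart_inv : chart_index -> 'rV[R]_n -> carrier;
  manifold_hausdorff : hausdorff_space carrier;
  manifold_second_countable : @second_countable carrier;
  chart_cover : forall p, exists a, chart_dom a p;
  chart_dom_open : forall a, open (chart_dom a);
  chart_image_open : forall a, open (chart a @` chart_dom a);
  chartK : forall a p, chart_dom a p -> chart_inv a (chart a p) = p;
  chart_continuous : forall a p, chart_dom a p -> {for p, continuous (chart a)};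
  chart_inv_continuous : forall a x, (chart a @` chart_dom a) x ->
    {for x, continuous (chart_inv a)};
  chart_compatible : forall a b,
    Cinfty (chart a @` (chart_dom a `&` chart_dom b))
           (chart b \o chart_inv a)
}.

Section TangentBundle.
Context (R : realType) (n : nat) (M : smooth_manifold R n).
Local Notation I := (chart_index M).

Definition transition (a b : I) : 'rV[R]_n -> 'rV[R]_n :=
  chart b \o chart_inv a.

(* A tangent vector at [foot] is the family of its components [fibre a] in the
   charts around [foot], related by the Jacobians of the transition maps.
   Setting [fibre a] to 0 for the other charts makes the family unique. *)
Record tangent := Tangent {
  foot : M;
  fibre : I -> 'rV[R]_n;
  fibre_off : forall a, ~ chart_dom a foot -> fibre a = 0;
  fibre_transition : forall a b, chart_dom a foot -> chart_dom b foot ->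
    fibre b = 'D_(fibre a) (transition a b) (chart a foot)
}.

(* Induced coordinates (x, y) on TM: the row vector of R^(n+n) whose left half
   is x and whose right half is y. *)
Definition tdom (a : I) : set tangent := [set u | chart_dom a (foot u)].

Definition tcoord (a : I) (u : tangent) : 'rV[R]_(n + n) :=
  row_mx (chart a (foot u)) (fibre u a).

Definition ttransition (a b : I) (z : 'rV[R]_(n + n)) : 'rV[R]_(n + n) :=
  row_mx (transition a b (lsubmx z))
         ('D_(rsubmx z) (transition a b) (lsubmx z)).

Definition timage (a : I) (Omega : set tangent) : set 'rV[R]_(n + n) :=
  tcoord a @` (Omega `&` tdom a).

(* The manifold topology of TM. *)
Definition topen (Omega : set tangent) : Prop :=
  forall a, open (timage a Omega).

(* [f] read in the induced coordinates, i.e. [f] composed with the inverse of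
   [tcoord a], which is injective on [tdom a]; the value outside
   [timage a setT] is irrelevant. *)
Definition local_rep (a : I) (f : tangent -> R) (z : 'rV[R]_(n + n)) : R :=
  xget 0 (f @` (tdom a `&` tcoord a @^-1` [set z])).

Definition Ck_on (k : nat) (Omega : set tangent) (f : tangent -> R) : Prop :=
  forall a, Ck k (timage a Omega) (local_rep a f).

End TangentBundle.

(* Calculus in one induced chart of TM, i.e. on open subsets of R^(n+n).
   Vector fields are row vectors of components on d/dx^i, d/dy^i, and 1-forms
   are row vectors of components on dx^i, dy^i. *)
Section LocalCalculus.
Context (R : realType) (n : nat).
Local Notation E := 'rV[R]_(n + n).

Definition coord_vec (k : 'I_(n + n)) : E := delta_mx 0 k.
Definition dy (i : 'I_n) : E := coord_vec (rshift n i).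

Definition pairing (alpha v : E) : R := \sum_k alpha 0 k * v 0 k.

Definition vf_app (X : E -> E) (f : E -> R) (z : E) : R := 'D_(X z) f z.

Definition exterior (f : E -> R) (z : E) : E := \row_k 'D_(coord_vec k) f z.

(* (L_X alpha)_k = X(alpha_k) + alpha_l (dX^l/dz^k). *)
Definition lie_form (X alpha : E -> E) (z : E) : E :=
  \row_k (vf_app X (fun w => alpha w 0 k) z +
          \sum_l alpha z 0 l * 'D_(coord_vec k) (fun w => X w 0 l) z).

Definition vert_endo (v : E) : E := row_mx 0 (lsubmx v).
Definition liouville (z : E) : E := row_mx 0 (rsubmx z).

(* On functions i_J is zero, so d_J L = i_J dL = dL o J. *)
Definition dJ (L : E -> R) (z : E) : E :=
  \row_k pairing (exterior L z) (vert_endo (coord_vec k)).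

Definition energy (L : E -> R) (z : E) : R := vf_app liouville L z - L z.

Definition lagrange_diff (S : E -> E) (L : E -> R) (z : E) : E :=
  lie_form S (dJ L) z - exterior L z.

Definition fibre_hessian (L : E -> R) (z : E) : 'M[R]_n :=
  \matrix_(i, j) 'D_(dy i) (fun w => 'D_(dy j) L w) z.

End LocalCalculus.

(* Objects on an open subset Omega of TM.  A vector field or 1-form is given by
   its components in every induced chart, with the tensorial change of charts;
   only the values on [timage a Omega] matter. *)
Section OnTangentBundle.
Context (R : realType) (n : nat) (M : smooth_manifold R n).
Local Notation I := (chart_index M).
Local Notation E := 'rV[R]_(n + n).

Definition is_vector_field (Omega : set (tangent M)) (X : I -> E -> E) : Prop :=
  (forall a, Cinfty (timage a Omega) (X a)) /\
  (forall a b u, Omega u -> tdom a u -> tdom b u ->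
    X b (tcoord b u) = 'D_(X a (tcoord a u)) (ttransition a b) (tcoord a u)).

Definition is_one_form (Omega : set (tangent M)) (alpha : I -> E -> E) : Prop :=
  (forall a, Cinfty (timage a Omega) (alpha a)) /\
  (forall a b u, Omega u -> tdom a u -> tdom b u -> forall v : E,
    pairing (alpha a (tcoord a u)) v =
    pairing (alpha b (tcoord b u)) ('D_v (ttransition a b) (tcoord a u))).

Definition is_semispray (Omega : set (tangent M)) (S : I -> E -> E) : Prop :=
  is_vector_field Omega S /\
  (forall a z, timage a Omega z -> vert_endo (S a z) = liouville z).

(* [S] is the semi-spray of the SODE x'' + 2 G(x, x') = 0. *)
Definition sode_semispray (Omega : set (tangent M)) (G : I -> E -> 'rV[R]_n)
    (S : I -> E -> E) : Prop :=
  forall a z, timage a Omega z ->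
    S a z = row_mx (rsubmx z) (- (2%:R *: G a z)).

Definition is_semibasic (Omega : set (tangent M)) (sigma : I -> E -> E) : Prop :=
  is_one_form Omega sigma /\
  (forall a z, timage a Omega z ->
    forall v : E, lsubmx v = 0 -> pairing (sigma a z) v = 0).

(* Like the other conditions "<> 0" on functions, non-triviality of the Hessian
   is required at every point. *)
Definition nontrivial_hessian (Omega : set (tangent M)) (L : tangent M -> R)
    : Prop :=
  forall a z, timage a Omega z -> fibre_hessian (local_rep a L) z <> 0.

Definition is_lagrangian (Omega : set (tangent M)) (L : tangent M -> R) : Prop :=
  (forall k, Ck_on k Omega L) /\ nontrivial_hessian Omega L.

(* Phi o L is only C^2 when Phi is, hence the class of [L] here. *)
Definition lagrangian_for (Omega : set (tangent M)) (S : I -> E -> E)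
    (L : tangent M -> R) : Prop :=
  [/\ Ck_on 2 Omega L, nontrivial_hessian Omega L &
      forall a z, timage a Omega z -> lagrange_diff (S a) (local_rep a L) z = 0].

Definition force_condition (Omega : set (tangent M)) (S sigma : I -> E -> E)
    (L : tangent M -> R) : Prop :=
  forall a z, timage a Omega z -> let La := local_rep a L in
    sigma a z = (vf_app (S a) (energy La) z / vf_app (@liouville R n) La z)
                *: dJ La z.

(* The quotient Phi''(L) / Phi'(L) has to be defined, and x / 0 = 0 in MathComp;
   hence the explicit Phi'(L) <> 0. *)
Definition deformation_ode (Omega : set (tangent M)) (S : I -> E -> E)
    (L : tangent M -> R) (Phi : R -> R) : Prop :=
  forall a z, timage a Omega z -> let La := local_rep a L in
    Phi^`()%classic (La z) <> 0 /\
    Phi^`(2)%classic (La z) / Phi^`()%classic (La z) =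
      - (vf_app (S a) (energy La) z /
         (vf_app (S a) La z * vf_app (@liouville R n) La z)).

Definition hessian_condition (Omega : set (tangent M)) (L : tangent M -> R)
    (Phi : R -> R) : Prop :=
  forall a z, timage a Omega z -> let La := local_rep a L in
    \matrix_(i < n, j < n)
      (Phi^`(2)%classic (La z) * 'D_(dy R j) La z * 'D_(dy R i) La z +
       Phi^`()%classic (La z) * 'D_(dy R i) (fun w => 'D_(dy R j) La w) z) <> 0.

Definition admissible_deformation (Phi : R -> R) : Prop :=
  Ck 2 [set: R] Phi /\ ~ (exists c, forall t, Phi t = c).

End OnTangentBundle.

(* Main.v *)
(* The deformed Lagrangian satisfies
     delta_S (Phi(L)) = Phi'(L) delta_S L + Phi''(L) S(L) d_J L,
   so with [delta_S L = sigma] it is a Lagrangian for S iff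
   [Phi' sigma = - Phi'' S(L) d_J L] and its Hessian, which is the matrix of
   condition (3), does not vanish. Contracting with S, where [i_S sigma = S(E_L)]
   and [i_S d_J L = C(L)], turns this equation into (1) and (2). *)
Require Import Defs.
From HB Require Import structures.
From mathcomp Require Import all_boot all_order all_algebra.
From mathcomp Require Import all_classical all_reals all_analysis.
From mathcomp Require Import ring.

Set Implicit Arguments.
Unset Strict Implicit.
Unset Printing Implicit Defensive.

Import Order.TTheory GRing.Theory Num.Theory.
Import numFieldNormedType.Exports.

Local Open Scope ring_scope.
Local Open Scope classical_set_scope.

(** * Locality of differentiability and the chain rule *)

Section Differentiability.
Context (R : realType) (V : normedModType R).
Implicit Types (U : set V) (phi : R -> R) (v : V).

(** The first-order expansion of [f] at [x] is also one for [g], and uniqueness of the differential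
    then gives ['d g x = 'd f x]. *)
Lemma near_eq_differentiable (W : normedModType R) (f g : V -> W) (x : V) :
  {near x, f =1 g} -> differentiable f x -> differentiable g x.
Proof.
move=> fg df.
have dfc : continuous ('d f x) by exact: diff_continuous.
have expansion : g \o shift x = cst (g x) + 'd f x +o_ 0 id.
  apply/eqaddoP => e e0.
  have /eqaddoP/(_ _ e0) := diff_locally df.
  have := fg; rewrite [X in X -> _](near_shift 0 x) => fg0 small.
  near=> h.
  have gh : f (h + x) = g (h + x).
    (* [near_shift] presents the base point as [x - 0]. *)
    by rewrite -[x in LHS]subr0 -[x in RHS]subr0; near: h.
  have : `|(f \o shift x - (cst (f x) + 'd f x)) h| <= e * `|id h| by near: h.
  by rewrite /= !fctE /= gh (nbhs_singleton fg).
apply/diff_locallyP; have -> := diff_unique dfc expansion.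
by split.
Unshelve. all: by end_near. Qed.

(** On an open set, equality at the points is equality near each point, so it passes to directional
    derivatives and the induction goes through. *)
Lemma Ck_eq (W : normedModType R) k U (f g : V -> W) :
  open U -> (forall x, U x -> f x = g x) -> Ck k U f -> Ck k U g.
Proof.
move=> oU; elim: k f g => [|k IHk] f g fg /=.
  move=> cf x Ux; have nfg : {near x, f =1 g}.
    by apply: filterS (open_nbhs_nbhs (conj oU Ux)) => y; exact: fg.
  rewrite /prop_for /continuous_at -fg//.
  by apply: cvg_trans (cf x Ux); apply: near_eq_cvg; exact: nfg.
have nfg x : U x -> {near x, f =1 g}.
  by move=> Ux; apply: filterS (open_nbhs_nbhs (conj oU Ux)) => y; exact: fg.
move=> [df ddf]; split=> [x Ux|v].
  exact: near_eq_differentiable (nfg x Ux) (df x Ux).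
by apply: IHk (ddf v) => x Ux; apply: near_eq_derive; exact: nfg.
Qed.

Lemma derive_scalar_comp phi (f : V -> R) x v :
  differentiable f x -> differentiable phi (f x) ->
  'D_v (phi \o f) x = phi^`()%classic (f x) * 'D_v f x.
Proof.
move=> df dphi; rewrite deriveE; last exact: differentiable_comp.
rewrite diff_comp// derive1E'// deriveE//= mulrC.
(* A linear map on [R] is multiplication by its value at 1. *)
by rewrite -[X in 'd phi _ X = _]mulr1 [LHS]linearZ.
Qed.

End Differentiability.

(** * Functions of class C^2 on the line and their composites *)

Section C2.
Context (R : realType) (phi : R -> R).

Lemma C2P : Ck 2 [set: R] phi ->
  [/\ forall t, differentiable phi t,
      forall t, differentiable phi^`()%classic t &
      continuous phi^`(2)%classic].
Proof.
move=> [dphi /(_ 1) [ddphi /(_ 1) cphi]].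
have E : (fun t => 'D_1 phi t) = phi^`()%classic.
  by apply/funext => t; rewrite derive1E.
have E2 : (fun t => 'D_1 phi^`()%classic t) = phi^`(2)%classic.
  by apply/funext => t; rewrite -derive1E.
rewrite E E2 in ddphi cphi.
by split=> t; [exact: dphi|exact: ddphi|exact: cphi].
Qed.

(** The chain and product rules give the explicit first and second directional derivatives [g] and
    [h] on [U]; their regularity is then read off factor by factor. *)
Lemma Ck2_comp (V : normedModType R) (U : set V) (f : V -> R) :
  open U -> Ck 2 [set: R] phi -> Ck 2 U f -> Ck 2 U (phi \o f).
Proof.
move=> oU /C2P[dphi dphi' cphi''] [df /= ddf].
split=> [x Ux|v]; first by apply: differentiable_comp => //; exact: df.
have [dDf cDDf] := ddf v.
pose g := (phi^`()%classic \o f) * (fun x => 'D_v f x).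
apply: (@Ck_eq _ _ _ 1 U g) => // [x Ux|].
  by rewrite derive_scalar_comp//; exact: df.
have dphi'f x : U x -> differentiable (phi^`()%classic \o f) x.
  by move=> Ux; apply: differentiable_comp => //; exact: df.
split=> [x Ux|w]; first by apply: differentiableM; [exact: dphi'f|exact: dDf].
pose h := (phi^`()%classic \o f) * (fun x => 'D_w (fun y => 'D_v f y) x) +
  (fun x => 'D_v f x) * ((phi^`(2)%classic \o f) * (fun x => 'D_w f x)).
apply: (@Ck_eq _ _ _ 0 U h) => // [x Ux|x Ux].
  rewrite deriveM; [|exact/diff_derivable/dphi'f|exact/diff_derivable/dDf].
  by rewrite (derive_scalar_comp _ (df x Ux)).
have cDf u : {for x, continuous (fun x => 'D_u f x)}.
  by apply: differentiable_continuous; have [+ _] := ddf u; apply.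
apply: continuousD; apply: continuousM => //=.
- exact/differentiable_continuous/dphi'f.
- exact: cDDf.
- apply: continuousM => //; apply: continuous_comp; last exact: cphi''.
  exact/differentiable_continuous/df.
Qed.

End C2.

(** * Pairings, d_J and the vertical endomorphism in one chart *)

Section ChartCalculus.
Context (R : realType) (n : nat).
Local Notation E := 'rV[R]_(n + n).
Implicit Types (f l F : E -> R) (S : E -> E) (U : set E) (z v w : E).

Lemma pairingZl (c : R) (alpha v : E) :
  pairing (c *: alpha) v = c * pairing alpha v.
Proof.
by rewrite /pairing mulr_sumr; apply: eq_bigr => k _; rewrite mxE mulrA.
Qed.

Lemma pairing_exterior f z v :
  differentiable f z -> pairing (exterior f z) v = 'D_v f z.
Proof.
move=> df; rewrite deriveE// {2}[v]row_sum_delta linear_sum.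
by apply: eq_bigr => k _; rewrite linearZ mxE deriveE// /= mulrC.
Qed.

(** As right multiplication by a constant matrix, J distributes over the coordinate expansion of a
    vector. *)
Lemma vert_endoE v : vert_endo v = v *m block_mx 0 1%:M 0 0.
Proof.
by rewrite -[v in RHS]hsubmxK mul_row_block !mulmx0 mulmx1 !addr0.
Qed.

Lemma dJE f z k :
  differentiable f z -> dJ f z 0 k = 'D_(vert_endo (coord_vec R k)) f z.
Proof. by move=> df; rewrite mxE pairing_exterior. Qed.

Lemma pairing_dJ f z v :
  differentiable f z -> pairing (dJ f z) v = 'D_(vert_endo v) f z.
Proof.
move=> df; rewrite deriveE// vert_endoE {2}[v]row_sum_delta.
rewrite mulmx_suml linear_sum; apply: eq_bigr => k _.
by rewrite dJE// deriveE// vert_endoE -scalemxAl linearZ /= mulrC.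
Qed.

(** * Effect of L -> Phi(L) on d_J, the Lagrange differential and the Hessian *)

Section Deformation.
Variables (U : set E) (l F : E -> R) (phi : R -> R).
Hypotheses (oU : open U) (dl : forall w, U w -> differentiable l w)
  (ddl : forall v w, U w -> differentiable (fun x => 'D_v l x) w)
  (dphi : forall t, differentiable phi t)
  (dphi' : forall t, differentiable phi^`()%classic t)
  (Fl : forall w, U w -> F w = phi (l w)).

Let nearU (W : Type) (f g : E -> W) z :
  (forall w, U w -> f w = g w) -> U z -> {near z, f =1 g}.
Proof.
by move=> fg Uz; apply: filterS (open_nbhs_nbhs (conj oU Uz)) => w; exact: fg.
Qed.

Lemma derive_deformation v w : U w ->
  'D_v F w = phi^`()%classic (l w) * 'D_v l w.
Proof.
move=> Uw; rewrite (near_eq_derive _ (nearU Fl Uw)).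
by rewrite (@derive_scalar_comp _ _ phi)//; exact: dl.
Qed.

Lemma exterior_deformation w : U w ->
  exterior F w = phi^`()%classic (l w) *: exterior l w.
Proof. by move=> Uw; apply/rowP => k; rewrite !mxE derive_deformation. Qed.

Lemma dJ_deformation w : U w -> dJ F w = phi^`()%classic (l w) *: dJ l w.
Proof.
by move=> Uw; apply/rowP => k; rewrite !mxE exterior_deformation// pairingZl.
Qed.

(** The source of every [phi''] term: [g] will be a component of [dJ l] for the Lagrange
    differential, and a fibre derivative of [l] for the Hessian. *)
Lemma derive_phi'M (g : E -> R) v z : U z -> differentiable g z ->
  'D_v (fun w => phi^`()%classic (l w) * g w) z =
  phi^`(2)%classic (l z) * 'D_v l z * g z + phi^`()%classic (l z) * 'D_v g z.
Proof.
move=> Uz dg.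
have dphi'l : differentiable (phi^`()%classic \o l) z.
  by apply: differentiable_comp => //; exact: dl.
have -> : (fun w => phi^`()%classic (l w) * g w) = (phi^`()%classic \o l) * g.
  by [].
rewrite deriveM; [|exact: diff_derivable|exact: diff_derivable].
rewrite (derive_scalar_comp _ (dl Uz))//= -![_ *: _]/(_ * _) addrC.
by rewrite [g z * _]mulrC.
Qed.

(** Near [w] this component is the derivative of [l] along the fixed vector J(e_k). *)
Lemma dJ_coord_differentiable k w : U w ->
  differentiable (fun x => dJ l x 0 k) w.
Proof.
move=> Uw; apply: near_eq_differentiable (ddl (vert_endo (coord_vec R k)) Uw).
by apply: (nearU _ Uw) => x Ux; rewrite dJE//; exact: dl.
Qed.

(** The form [dF] and the terms of the Lie derivative containing derivatives of [S] are merely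
    scaled by [phi']; the extra term comes from [S] differentiating the factor [phi'(l)] in front of
    [dJ l]. *)
Lemma lagrange_diff_deformation S z : U z ->
  lagrange_diff S F z = phi^`()%classic (l z) *: lagrange_diff S l z +
    (phi^`(2)%classic (l z) * vf_app S l z) *: dJ l z.
Proof.
move=> Uz; rewrite /lagrange_diff exterior_deformation//; apply/rowP => k.
have dJFk : forall w, U w -> dJ F w 0 k = phi^`()%classic (l w) * dJ l w 0 k.
  by move=> w Uw; rewrite dJ_deformation// mxE.
have : lie_form S (dJ F) z 0 k =
    phi^`()%classic (l z) * lie_form S (dJ l) z 0 k +
    phi^`(2)%classic (l z) * vf_app S l z * dJ l z 0 k.
  rewrite [LHS]mxE [lie_form S (dJ l) z 0 k]mxE.
  rewrite {1}/vf_app (near_eq_derive _ (nearU dJFk Uz)).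
  rewrite derive_phi'M//; last exact: dJ_coord_differentiable.
  under eq_bigr => i _ do rewrite dJ_deformation// mxE -mulrA.
  rewrite -mulr_sumr /vf_app.
  by ring.
(* Generalizing the forms keeps [mxE] from unfolding their components. *)
move: (lie_form _ _ _) (lie_form _ _ _) (dJ _ _) (exterior _ _) => A B C D.
by rewrite !mxE => ->; ring.
Qed.

Lemma fibre_hessian_deformation z : U z ->
  fibre_hessian F z = \matrix_(i < n, j < n)
    (phi^`(2)%classic (l z) * 'D_(dy R j) l z * 'D_(dy R i) l z +
     phi^`()%classic (l z) * 'D_(dy R i) (fun w => 'D_(dy R j) l w) z).
Proof.
move=> Uz; apply/matrixP => i j; rewrite !mxE.
have dF : forall w, U w ->
    'D_(dy R j) F w = phi^`()%classic (l w) * 'D_(dy R j) l w.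
  by move=> w; exact: derive_deformation.
rewrite (near_eq_derive _ (nearU dF Uz)) derive_phi'M//; last exact: ddl.
by ring.
Qed.

(** * Contractions with a semi-spray *)

Section Semispray.
Variable S : E -> E.
Hypothesis JS : forall w, U w -> vert_endo (S w) = liouville w.

Lemma pairing_dJ_semispray z : U z ->
  pairing (dJ l z) (S z) = vf_app (@liouville R n) l z.
Proof. by move=> Uz; rewrite pairing_dJ ?JS//; exact: dl. Qed.

(* [i_S (L_S d_J l) = S (i_S d_J l) = S (C l)] and [i_S dl = S l]. *)
Lemma pairing_lagrange_diff z : U z -> differentiable S z ->
  pairing (lagrange_diff S l z) (S z) = vf_app S (energy l) z.
Proof.
move=> Uz dS; set v := S z.
have dSk k : differentiable (fun w => S w 0 k) z.
  by apply: (@differentiable_comp _ _ _ _ S (fun A : E => A 0 k)) => //;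
    exact: differentiable_coord.
have dSum k : differentiable ((fun w => dJ l w 0 k) * (fun w => S w 0 k)) z.
  by apply: differentiableM => //; exact: dJ_coord_differentiable.
(* [Cl] is i_S d_J l in coordinates. It equals C(l) on [U] and, being a sum of products, can be
   differentiated by the product rule. *)
pose Cl := \sum_k ((fun w => dJ l w 0 k) * (fun w => S w 0 k)).
have ClE w : U w -> energy l w = (Cl - l) w.
  move=> Uw; rewrite /energy -pairing_dJ_semispray// /Cl /pairing.
  by rewrite !fctE fct_sumE.
rewrite /vf_app (near_eq_derive _ (nearU ClE Uz)) -/v.
rewrite deriveB; [|exact/diff_derivable/differentiable_sum
                  |exact/diff_derivable/dl].
rewrite derive_sum => [|k]; last exact: diff_derivable.
have dvS k : 'D_v (fun w => S w 0 k) z =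
    \sum_j v 0 j * 'D_(coord_vec R j) (fun w => S w 0 k) z.
  rewrite -pairing_exterior//; apply: eq_bigr => j _.
  by rewrite mxE mulrC.
have -> : \sum_k 'D_v ((fun w => dJ l w 0 k) * (fun w => S w 0 k)) z =
    \sum_k (v 0 k * 'D_v (fun w => dJ l w 0 k) z +
            \sum_j dJ l z 0 k *
                   (v 0 j * 'D_(coord_vec R j) (fun w => S w 0 k) z)).
  apply: eq_bigr => k _; rewrite deriveM; last 2 first.
  - exact/diff_derivable/dJ_coord_differentiable.
  - exact: diff_derivable.
  by rewrite dvS addrC -mulr_sumr.
(* Exchanging the double sum makes the factor of [v 0 k] the k-th component of L_S d_J l. *)
rewrite big_split/= exchange_big/= -big_split/=.
rewrite -pairing_exterior; last exact: dl.
rewrite /pairing -sumrB; apply: eq_bigr => k _.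
rewrite [lagrange_diff _ _ _ _ _]mxE [lie_form _ _ _ _ _]mxE [in LHS]mxE.
rewrite mulrBl mulrDl mulr_suml mulrC; congr (_ + _ - _).
by apply: eq_bigr => j _; ring.
Qed.

End Semispray.
End Deformation.
End ChartCalculus.

(** * Reading functions on TM in induced coordinates *)

Section LocalRepresentative.
Context (R : realType) (n : nat) (M : smooth_manifold R n).

(** The components in chart [a] fix those in every other chart around the foot by
    [fibre_transition], and [fibre_off] fixes the rest. *)
Lemma tcoord_inj (a : chart_index M) (u u' : tangent M) :
  tdom a u -> tdom a u' -> tcoord a u = tcoord a u' -> u = u'.
Proof.
case: u u' => [p f f0 ft] [q g g0 gt]; rewrite /tdom /tcoord /= => ap aq.
move=> /eq_row_mx[] pq fg.
have {}pq : p = q by rewrite -(chartK ap) -(chartK aq) pq.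
case: _ / pq in aq g0 gt *; have {}fg : f = g.
  apply/funext => b; have [bp|bp] := pselect (chart_dom b p).
    by rewrite (ft a b)// (gt a b)// fg.
  by rewrite f0// g0.
by case: _ / fg in g0 gt *; congr Tangent; exact: Prop_irrelevance.
Qed.

Lemma local_rep_tcoord (a : chart_index M) (f : tangent M -> R) u :
  tdom a u -> local_rep a f (tcoord a u) = f u.
Proof.
move=> au; rewrite /local_rep.
have -> : f @` (tdom a `&` tcoord a @^-1` [set tcoord a u]) = [set f u].
  apply/seteqP; split=> [_ [u' [au' /= uu'] <-]|_ ->].
    by rewrite (tcoord_inj au' au uu').
  by exists u.
by case: xgetP => [y _ ->//|/(_ (f u))/(_ erefl)].
Qed.

(** Off the image of the chart a representative is 0 by default, so the two sides would be 0 and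
    [phi 0] there. *)
Lemma local_rep_comp (a : chart_index M) (Omega : set (tangent M))
    (f : tangent M -> R) (phi : R -> R) z :
  timage a Omega z -> local_rep a (phi \o f) z = phi (local_rep a f z).
Proof. by move=> [u [_ au] <-]; rewrite !local_rep_tcoord. Qed.

End LocalRepresentative.

(** * Equivalence of the Lagrange equation for Phi(L) with the three conditions *)

Theorem theorem1 (R : realType) (n : nat) (M : smooth_manifold R n)
  (Omega : set (tangent M)) (Omega_open : topen Omega)
  (G : chart_index M -> 'rV[R]_(n + n) -> 'rV[R]_n)
  (S : chart_index M -> 'rV[R]_(n + n) -> 'rV[R]_(n + n))
  (S_semispray : is_semispray Omega S) (S_sode : sode_semispray Omega G S)
  (L : tangent M -> R) (L_lagrangian : is_lagrangian Omega L)
  (sigma : chart_index M -> 'rV[R]_(n + n) -> 'rV[R]_(n + n))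
  (sigma_semibasic : is_semibasic Omega sigma)
  (lagrange_eq : forall a z, timage a Omega z ->
     lagrange_diff (S a) (local_rep a L) z = sigma a z)
  (SL_neq0 : forall a z, timage a Omega z ->
     vf_app (S a) (local_rep a L) z <> 0)
  (CL_neq0 : forall a z, timage a Omega z ->
     vf_app (@liouville R n) (local_rep a L) z <> 0) :
  ((exists Phi : R -> R,
      admissible_deformation Phi /\ lagrangian_for Omega S (Phi \o L)) <->
   (exists Phi : R -> R,
      [/\ admissible_deformation Phi, force_condition Omega S sigma L,
          deformation_ode Omega S L Phi & hessian_condition Omega L Phi])) /\
  (forall Phi : R -> R, admissible_deformation Phi ->
     (lagrangian_for Omega S (Phi \o L) <->
      [/\ force_condition Omega S sigma L, deformation_ode Omega S L Phi &
          hessian_condition Omega L Phi])).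
Proof.
have dL a v w : timage a Omega w ->
    differentiable (fun x => 'D_v (local_rep a L) x) w.
  by have [_ /(_ v)[+ _]] := L_lagrangian.1 2 a; apply.
have dL0 a w : timage a Omega w -> differentiable (local_rep a L) w.
  by have [+ _] := L_lagrangian.1 1 a; apply.
have dS a z : timage a Omega z -> differentiable (S a) z.
  by have [+ _] := S_semispray.1.1 a 1; apply.
have SE a z : timage a Omega z ->
    pairing (sigma a z) (S a z) = vf_app (S a) (energy (local_rep a L)) z.
  move=> Oz; rewrite -lagrange_eq// (pairing_lagrange_diff (Omega_open a))//.
  - exact: dL0.
  - exact: dL.
  - exact: S_semispray.2.
  - exact: dS.
have CL a z : timage a Omega z -> pairing (dJ (local_rep a L) z) (S a z) =
    vf_app (@liouville R n) (local_rep a L) z.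
  move=> Oz; apply: (pairing_dJ_semispray (dL0 a)) => //.
  exact: S_semispray.2.
(* Both existential statements range over admissible [Phi], so the equivalence for each fixed [Phi]
   yields theirs. *)
suff key Phi : admissible_deformation Phi ->
    lagrangian_for Omega S (Phi \o L) <->
      [/\ force_condition Omega S sigma L, deformation_ode Omega S L Phi &
          hessian_condition Omega L Phi].
  split=> //; split=> -[Phi].
    by move=> [adm /(key _ adm)[]]; exists Phi.
  by move=> [adm *]; exists Phi; split=> //; apply/key.
move=> [Phi2 _]; have [dPhi dPhi' _] := C2P Phi2.
have deltaE a z : timage a Omega z ->
    lagrange_diff (S a) (local_rep a (Phi \o L)) z =
    Phi^`()%classic (local_rep a L z) *: sigma a z +
    (Phi^`(2)%classic (local_rep a L z) * vf_app (S a) (local_rep a L) z)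
      *: dJ (local_rep a L) z.
  move=> Oz; rewrite -lagrange_eq//.
  apply: (lagrange_diff_deformation (Omega_open a)) => //.
  - exact: dL0.
  - exact: dL.
  - by move=> w; exact: local_rep_comp.
have hessE a z : timage a Omega z ->
    fibre_hessian (local_rep a (Phi \o L)) z = \matrix_(i < n, j < n)
    (Phi^`(2)%classic (local_rep a L z) * 'D_(dy R j) (local_rep a L) z
       * 'D_(dy R i) (local_rep a L) z +
     Phi^`()%classic (local_rep a L z) *
       'D_(dy R i) (fun w => 'D_(dy R j) (local_rep a L) w) z).
  move=> Oz; apply: (fibre_hessian_deformation (Omega_open a)) => //.
  - exact: dL0.
  - exact: dL.
  - by move=> w; exact: local_rep_comp.
split=> [[_ hess delta0]|[force ode hess]].
  (* Where [Phi' = 0] the equation leaves [Phi'' S(L) d_J L = 0], so [Phi'' = 0]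
     as well and the Hessian of [Phi(L)] vanishes. *)
  have Phi'_neq0 a z : timage a Omega z ->
      Phi^`()%classic (local_rep a L z) <> 0.
    move=> Oz Phi'0; apply: (hess a z Oz); rewrite hessE//.
    have /(congr1 (fun alpha => pairing alpha (S a z))) := delta0 a z Oz.
    rewrite deltaE// Phi'0 scale0r add0r pairingZl CL//.
    rewrite [RHS]/pairing big1 => [|k _]; last by rewrite mxE mul0r.
    move=> /eqP; rewrite !mulf_eq0 => /orP[/orP[/eqP Phi''0|/eqP]|/eqP].
    - by apply/matrixP => i j; rewrite !mxE Phi''0 !mul0r addr0.
    - by move/SL_neq0 => /(_ Oz).
    - by move/CL_neq0 => /(_ Oz).
  (* Dividing the deformed equation by [Phi'] shows that [sigma] is a multiple of d_J L. *)
  have sigmaE a z (Oz : timage a Omega z) : sigma a z =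
      - (Phi^`(2)%classic (local_rep a L z) / Phi^`()%classic (local_rep a L z)
         * vf_app (S a) (local_rep a L) z) *: dJ (local_rep a L) z.
    have /eqP Phi'0 := Phi'_neq0 a z Oz.
    have := delta0 a z Oz; rewrite deltaE// => /eqP.
    rewrite addr_eq0 => /eqP.
    move=> /(congr1 ( *:%R (Phi^`()%classic (local_rep a L z))^-1)).
    rewrite scalerA mulVf// scale1r => ->.
    by rewrite -scaleNr scalerA; congr (_ *: _); ring.
  (* Contracting with [S] identifies that multiple as S(E_L)/C(L); this gives (1), and solving for
     [Phi''/Phi'] gives (2). *)
  have SEE a z (Oz : timage a Omega z) :
      vf_app (S a) (energy (local_rep a L)) z =
      - (Phi^`(2)%classic (local_rep a L z) / Phi^`()%classic (local_rep a L z)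
         * vf_app (S a) (local_rep a L) z)
      * vf_app (@liouville R n) (local_rep a L) z.
    by rewrite -SE// sigmaE// pairingZl CL.
  split=> [a z Oz /=|a z Oz /=|a z Oz /=].
  - rewrite SEE// mulfK; last exact/eqP/CL_neq0.
    exact: sigmaE.
  - split; first exact: Phi'_neq0.
    have /eqP SL0 := SL_neq0 a z Oz; have /eqP CL0 := CL_neq0 a z Oz.
    rewrite SEE// !mulNr opprK -[_ * _ * vf_app (@liouville R n) _ _]mulrA.
    by rewrite mulfK// mulf_neq0.
  - by rewrite -hessE//; exact: hess.
split=> [a|a z Oz|a z Oz].
- apply: (@Ck_eq _ _ _ 2 _ (Phi \o local_rep a L)) => //.
  + by move=> z Oz; rewrite (local_rep_comp _ _ Oz).
  + by apply: Ck2_comp => //; exact: L_lagrangian.1.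
- by rewrite hessE//; exact: hess.
(* By (1) everything is a multiple of d_J L, with coefficient [Phi' S(E_L)/C(L) + Phi'' S(L)], which
   vanishes by (2). *)
- rewrite deltaE// force// scalerA -scalerDl.
  have [/eqP Phi'0] := ode a z Oz.
  have /eqP SL0 := SL_neq0 a z Oz; have /eqP CL0 := CL_neq0 a z Oz.
  move=> /(congr1 ( *%R^~ (Phi^`()%classic (local_rep a L z)))).
  rewrite divfK// => ->.
  rewrite [X in X *: _](_ : _ = 0) ?scale0r//.
  move: SL0 CL0; move: (vf_app _ _ z) (vf_app _ _ z) => c s s0 c0.
  by field; rewrite s0 c0.
Qed.
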